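(* Let $G$ be a group with identity element $e$ and let $R$ be a $G$-graded ring. Suppose that $R_e$ is a prime ring and that $R$ is right (or left) non-degenerately $G$-graded. If $f$ is a nonzero central idempotent in $R$, then $f$ has finite support group. In particular, if $G$ is torsion-free, then every central idempotent in $R$ is contained in $R_e$.
   Context: Rings are associative but not necessarily unital and not necessarily commutative. A ring $R$ is $G$-graded if there is a collection of additive subgroups $\{R_g\}_{g\in G}$ of $R$ such that $R=\bigoplus_{g\in G} R_g$ and $R_gR_h\subseteq R_{gh}$ for all $g,h\in G$. A $G$-graded ring $R$ is right non-degenerately $G$-graded (resp. left non-degenerately $G$-graded) if, for each $g\in G$ and each nonzero $r_g\in R_g$, we have $r_gR_{g^{-1}}\neq\{0\}$ (resp. $R_{g^{-1}}r_g\neq\{0\}$). The support of a nonzero element $r=\sum_{g\in G} r_g$ (with $r_g\in R_g$) is the finite set $\operatorname{Supp}(r)=\{g\in G\mid r_g\neq 0\}$. The support group of $r$ is the subgroup of $G$ generated by $\operatorname{Supp}(r)$. *)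

(* Defs.v *)
From HB Require Import structures.
From mathcomp Require Import all_boot all_algebra.
From mathcomp Require Import all_classical.

Set Implicit Arguments.
Unset Strict Implicit.
Unset Printing Implicit Defensive.

Import GRing.Theory.

Local Open Scope classical_set_scope.
Local Open Scope ring_scope.

(* Associative rings, not necessarily unital and not necessarily commutative
   (GRing only has unital rings): the additive structure is a zmodType, and the
   product is that of a semigroupType, hence written (x * y)%g. *)
HB.mixin Record ZmoduleSemigroup_isRng R of GRing.Zmodule R & Semigroup R := {
  rng_mulDl : forall x y z : R, ((x + y)%R * z = (x * z)%g + (y * z)%g :> R)%g;
  rng_mulDr : forall x y z : R, (x * (y + z)%R = (x * y)%g + (x * z)%g :> R)%g
}.

#[short(type="rngType")]
HB.structure Definition Rng :=
  {R of ZmoduleSemigroup_isRng R & GRing.Zmodule R & Semigroup R}.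

Section Rings.
Variable R : rngType.
Implicit Types (S A B I J : set R) (x f : R).

Definition additive_subgroup A : Prop := zmod_closed (mem A).

(* The product AB of ring theory: all finite sums of products a * b. *)
Definition setprod A B : set R :=
  [set x | exists (n : nat) (a b : 'I_n -> R),
    [/\ forall i, A (a i), forall i, B (b i) & x = \sum_(i < n) (a i * b i)%g]].

(* I is a two-sided ideal of the subring S of R. *)
Definition ideal_of S I : Prop :=
  [/\ I `<=` S, additive_subgroup I, setprod S I `<=` I & setprod I S `<=` I].

(* The subring S of R, seen as a ring of its own, is prime. *)
Definition prime_subring S : Prop :=
  S <> [set 0] /\
  forall I J, ideal_of S I -> ideal_of S J -> setprod I J = [set 0] ->
    I = [set 0] \/ J = [set 0].

Definition central_elt f : Prop := forall x, (f * x = x * f)%g.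

Definition idempotent_elt f : Prop := (f * f = f)%g.

End Rings.

Section Groups.
Variable G : groupType.

Definition subgroup (H : set G) : Prop := group_closed (mem H).

Definition subgroup_generated (X : set G) : set G := smallest subgroup X.

Definition torsion_free : Prop :=
  forall (g : G) (n : nat), (0 < n)%N -> (g ^+ n = 1)%g -> (g = 1)%g.

End Groups.

Section Gradings.
Variables (G : groupType) (R : rngType).
Implicit Types (r : R) (c : G -> R).

(* r = \sum_g c g with c g in R_ g, and c g = 0 for all but finitely many g. *)
Definition decomposition (R_ : G -> set R) r c : Prop :=
  [/\ finite_set [set g | c g <> 0], forall g, R_ g (c g)
    & r = \sum_(g \in [set: G]) c g].

Definition graded (R_ : G -> set R) : Prop :=
  [/\ forall g, additive_subgroup (R_ g),
      forall r, exists! c, decomposition R_ r c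
    & forall g h, setprod (R_ g) (R_ h) `<=` R_ (g * h)%g].

(* component R_ r g is r_g; the default value fun=> 0 of xget is never used
   when R_ is a grading. *)
Definition component (R_ : G -> set R) r : G -> R := xget (fun=> 0) (decomposition R_ r).

Definition Supp (R_ : G -> set R) r : set G := [set g | component R_ r g <> 0].

Definition support_group (R_ : G -> set R) r : set G := subgroup_generated (Supp R_ r).

Definition right_nondegenerate (R_ : G -> set R) : Prop :=
  forall g r, R_ g r -> r <> 0 -> setprod [set r] (R_ (g^-1)%g) <> [set 0].

Definition left_nondegenerate (R_ : G -> set R) : Prop :=
  forall g r, R_ g r -> r <> 0 -> setprod (R_ (g^-1)%g) [set r] <> [set 0].

End Gradings.

(* Main.v *)
From HB Require Import structures.
Require Import Defs.
From mathcomp Require Import all_boot all_order all_algebra.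
From mathcomp Require Import all_classical.
From mathcomp Require Import zify.

(** Write f_g for the homogeneous components of a central idempotent f.

    Comparing components in f x = x f for x in R_h gives f_g x = x f_(g ^ h),
    where g ^ h = h^-1 g h [central_component].  In particular every f_g
    centralizes R_e, so f_g R_(g^-1) and R_(g^-1) f_g are ideals of R_e;
    non-degeneracy makes one of them nonzero, and primeness of R_e then makes
    both nonzero and forbids f_g f_h = 0 for g, h in the support
    [centralizing_mul_neq0].  Since f_g f_h = f_h f_(g ^ h), the finite set
    Supp f is closed under conjugation by its own elements [Supp_conj].

    Let K be the support group.  It acts by conjugation on its finite
    generating set Supp f, and the kernel of this action is the centre Z of K,
    which therefore has finite index.  Two facts about such groups are needed.
    If all generators are torsion then K is finite, which is Dietzmann's lemma
    [finite_generated_torsion].  If some generator x has infinite order, then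
    some morphism from K to the additive group of rational numbers is nonzero
    at x [torsion_of_no_degree]: a power z of x is a non-torsion element of Z,
    there is a morphism Z -> Q with value 1 at z [rational_degree], and
    composing it with the transfer K -> Z multiplies it by the index of Z on Z
    [transfer].

    It remains to see that a morphism phi : K -> Q vanishes on Supp f
    [idempotent_degree].  After clearing denominators, phi makes f an
    idempotent f = sum_c F_c of a Z-graded ring, and the claim is that f has
    degree 0.  Think of f(t) = sum_c t^c F_c, again a central idempotent: its
    Hasse derivatives at t = 1 vanish in every order k > 0, by induction on k,
    because the Leibniz rule gives D f = 2 f D f for the first nonvanishing
    one, whence f D f = 2 f D f and D f = 0.  This works in any characteristic.
    To keep exponents in nat, f(t) is multiplied by t^m with m large; the
    induction then reads sum_g 'C(w g, k) f_g = 'C(m, k) f, with w g the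
    shifted degree of g, and taking k = w g or k = m forces w g = m. *)

Set Implicit Arguments.
Unset Strict Implicit.
Unset Printing Implicit Defensive.

Import Order.TTheory GRing.Theory Num.Theory.
Local Open Scope classical_set_scope.
Local Open Scope ring_scope.

(** * Subgroups *)

Section Subgroups.
Local Open Scope group_scope.
Variables (G : groupType) (H : set G).
Hypothesis Hsub : subgroup H.

Lemma subgroup1 : H 1.
Proof. by case: Hsub; rewrite inE. Qed.

Lemma subgroupV x : H x -> H x^-1.
Proof. by move/mem_set/(group_closedV Hsub); rewrite inE. Qed.

Lemma subgroupM x y : H x -> H y -> H (x * y).
Proof. by move=> /mem_set xH /mem_set /(group_closedM Hsub xH); rewrite inE. Qed.

Lemma subgroupX x n : H x -> H (x ^+ n).
Proof.
move=> xH; elim: n => [|n IHn]; first exact: subgroup1.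
by rewrite expgS; apply: subgroupM.
Qed.
End Subgroups.

Lemma subgroupP (G : groupType) (H : set G) :
  H 1%g -> (forall x y, H x -> H y -> H (x / y)%g) -> subgroup H.
Proof. by move=> H1 HF; split=> [|x y]; rewrite !inE //; apply: HF. Qed.

Section GeneratedSubgroup.
Local Open Scope group_scope.
Variables (G : groupType) (X : set G).

Lemma subgroup_generated_subgroup : subgroup (subgroup_generated X).
Proof.
apply: subgroupP => [H [Hsub _]|x y xK yK H HP]; first exact: subgroup1.
have [Hsub _] := HP.
apply: (subgroupM Hsub); first exact: xK.
by apply: (subgroupV Hsub); apply: yK.
Qed.

Lemma sub_subgroup_generated : X `<=` subgroup_generated X.
Proof. exact: sub_gen_smallest. Qed.

Lemma subgroup_generated_min (H : set G) :
  subgroup H -> X `<=` H -> subgroup_generated X `<=` H.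
Proof. exact: smallest_sub. Qed.

End GeneratedSubgroup.

(** * Rational characters of abelian groups *)

Section RationalDegree.
Variables (V : zmodType) (z : V).
Hypothesis z_free : forall k : int, z *~ k = 0 -> k = 0.

Let avoids (N : set V) : Prop :=
  (forall x y, N x -> N y -> N (x - y)) /\ (forall k : int, N (z *~ k) -> k = 0).

Let maximal_avoiding : exists N, avoids N /\ forall M, N `<` M -> ~ avoids M.
Proof.
apply: Zorn_bigcup => F FP Ftot; split; last by move=> k [N /FP[_ Nz] /Nz].
move=> a b [N FN Na] [M FM Mb].
have [NM|MN] := Ftot _ _ FN FM.
  by have [+ _] := FP _ FM; exists M => //; auto.
by have [+ _] := FP _ FN; exists N => //; auto.
Qed.

(** Let N be a subgroup maximal among those that meet the multiples of z
    trivially.  By maximality, for each a some nonzero multiple m a lies in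
    k z + N for an integer k, and psi a = k / m is well defined because N
    contains no nonzero multiple of z. *)
Lemma rational_degree :
  exists psi : V -> rat, {morph psi : a b / a + b} /\ psi z = 1.
Proof.
have [N [[NB Nz] Nmax]] := maximal_avoiding.
(* The empty set also satisfies [avoids]; maximality rules it out. *)
have N0 : N 0.
  apply: contrapT => N0; apply: (Nmax [set 0]).
    split=> [x Nx|eqN]; last by apply: N0; apply/eqN.
    by exfalso; apply: N0; rewrite -(subrr x); apply: NB.
  split=> [x y -> ->|k]; [by rewrite /= subr0|exact: z_free].
have NN x : N x -> N (- x) by move=> Nx; rewrite -sub0r; apply: NB.
have ND x y : N x -> N y -> N (x + y).
  by move=> Nx Ny; rewrite -(opprK y); apply/NB/NN.
have NMn x n : N x -> N (x *+ n).
  by move=> Nx; elim: n => [//|n IHn]; rewrite mulrS; apply: ND.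
have NMz x (k : int) : N x -> N (x *~ k).
  by move=> Nx; case: k => n; [apply: NMn|apply/NN/NMn].
(* The pair t = (m, k) witnesses that psi a = k / m. *)
pose rel a (t : int * int) := t.1 != 0 /\ N (a *~ t.1 - z *~ t.2).
have rel_uniq a t t' : rel a t -> rel a t' -> (t.2%:~R / t.1%:~R = t'.2%:~R / t'.1%:~R :> rat).
  move=> [t0 Nt] [t0' Nt']; apply/eqP; rewrite eqr_div ?intr_eq0 //.
  rewrite -!rmorphM /= eqr_int -subr_eq0; apply/eqP/Nz.
  have -> : z *~ (t.2 * t'.1 - t'.2 * t.1)
      = (a *~ t'.1 - z *~ t'.2) *~ t.1 - (a *~ t.1 - z *~ t.2) *~ t'.1.
    by rewrite !mulrzBl -!mulrzA [t'.1 * t.1]mulrC opprB [RHS]addrC subrKA mulrzBr.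
  by apply: NB; apply: NMz.
have rel_ex a : exists t, rel a t.
  have [Na|Na] := pselect (N a).
    by exists (1, 0); split=> //=; rewrite subr0.
  apply: contrapT => nR.
  (* Otherwise the subgroup N + Z a would still avoid the multiples of z. *)
  apply: (Nmax [set x | exists k : int, N (x - a *~ k)]).
    split=> [x Nx|eqN]; first by exists 0; rewrite subr0.
    by apply/Na/eqN; exists 1; rewrite subrr.
  split=> [x y [k Nk] [l Nl]|k [l Nl]].
    exists (k - l); rewrite mulrzBr opprB addrACA [- y + _]addrC addrACA.
    by rewrite -[_ - y]opprB; apply: NB.
  have [l0|l0] := eqVneq l 0; first by apply: Nz; move: Nl; rewrite l0 subr0.
  by case: nR; exists (l, k); split=> //=; rewrite -opprB; apply: NN.
have [t tP] := choice rel_ex.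
exists (fun a => (t a).2%:~R / (t a).1%:~R); split=> [a b|]; last first.
  rewrite (rel_uniq _ _ (1, 1) (tP z)) ?divr1 //; split=> //=.
  by rewrite subrr.
have [ta0 Na] := tP a; have [tb0 Nb] := tP b.
rewrite (rel_uniq _ _ ((t a).1 * (t b).1, (t a).2 * (t b).1 + (t b).2 * (t a).1) (tP _)).
  by rewrite /= addf_div ?intr_eq0 // rmorphD !rmorphM.
split; rewrite /= ?mulf_neq0 //.
have -> : (a + b) *~ ((t a).1 * (t b).1) -
    z *~ ((t a).2 * (t b).1 + (t b).2 * (t a).1)
    = (a *~ (t a).1 - z *~ (t a).2) *~ (t b).1
      + (b *~ (t b).1 - z *~ (t b).2) *~ (t a).1.
  rewrite !mulrzBl -!mulrzA mulrzDl mulrzDr opprD addrACA.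
  by rewrite [(t b).1 * _]mulrC.
by apply: ND; apply: NMz.
Qed.
End RationalDegree.

(** The abelian subgroup is turned into an additive group, so that integer
    multiples and the additive lemmas become available. *)
Section AbelianSubgroup.
Local Open Scope group_scope.
Variables (G : groupType) (A : set G).
Hypotheses (Asub : subgroup A)
  (Acomm : forall a b, A a -> A b -> commute a b).

Let V := {x : G | x \in A}.
HB.instance Definition _ := Choice.on V.

Let mkV x (Ax : A x) : V := exist _ x (mem_set Ax).
Let valV (v : V) : A (val v). Proof. exact/set_mem/(valP v). Qed.
Let addV (u v : V) := mkV (subgroupM Asub (valV u) (valV v)).
Let oppV (u : V) := mkV (subgroupV Asub (valV u)).
Let zeroV : V := mkV (subgroup1 Asub).

Let addVA : associative addV.
Proof. by move=> u v w; apply: val_inj; rewrite /= mulgA. Qed.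
Let addVC : commutative addV.
Proof. by move=> u v; apply: val_inj; apply: Acomm; apply: valV. Qed.
Let add0V : left_id zeroV addV.
Proof. by move=> u; apply: val_inj; rewrite /= mul1g. Qed.
Let addNV : left_inverse zeroV oppV addV.
Proof. by move=> u; apply: val_inj; rewrite /= mulVg. Qed.

HB.instance Definition _ := GRing.isZmodule.Build V addVA addVC add0V addNV.

Lemma abelian_subgroup_degree z : A z ->
    (forall n, (0 < n)%N -> z ^+ n <> 1) ->
  exists psi : G -> rat,
    (forall a b, A a -> A b -> psi (a * b) = (psi a + psi b)%R) /\
    psi z = 1%R.
Proof.
move=> Az z_free.
have valMn (v : V) n : val (v *+ n)%R = val v ^+ n.
  by elim: n => [//|n IHn]; rewrite mulrS expgS -IHn.
have free (k : int) : (mkV Az *~ k = 0 -> k = 0)%R.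
  case: k => [[//|n]|n] /(congr1 val) e; exfalso; apply: (z_free n.+1) => //.
    by rewrite -[z]/(val (mkV Az)) -valMn e.
  by apply: invg_inj; rewrite invg1 -[z]/(val (mkV Az)) -valMn; apply: e.
have [psi [psiD psiz]] := rational_degree free.
exists (fun x => if pselect (A x) is left Ax then psi (mkV Ax) else 0%R).
split=> [a b Aa Ab|]; last first.
  by case: pselect => // Az'; rewrite -psiz; congr psi; apply: val_inj.
case: pselect => [Aab|/(_ (subgroupM Asub Aa Ab))//].
case: pselect => // Aa'; case: pselect => // Ab'.
by rewrite -psiD; congr psi; apply: val_inj.
Qed.

End AbelianSubgroup.

(** * Transfer to a central subgroup of finite index *)

(** The classes of [cl] are the cosets of the central subgroup A, which has
    finite index since [cl] takes finitely many values. *)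
Section Transfer.
Local Open Scope group_scope.
Variables (G : groupType) (K A : set G) (T : finType) (cl : G -> T).
Hypotheses (Ksub : subgroup K) (AK : A `<=` K)
  (Acent : forall a k, A a -> K k -> commute a k)
  (clP : forall k l, K k -> K l -> cl k = cl l <-> A (k / l)).

(** With s a section of the coset space Q and zeta k q in A defined by
    k s(q) = zeta k q * s(k q), the sum phi k of the psi (zeta k q) over Q is
    a morphism by the cocycle identity for zeta and reindexing along the
    permutation of Q given by l.  For a in A, zeta a q = a for all q. *)
Lemma transfer (psi : G -> rat) :
    (forall a b, A a -> A b -> psi (a * b) = (psi a + psi b)%R) ->
  exists phi : G -> rat,
    (forall k l, K k -> K l -> phi (k * l) = (phi k + phi l)%R) /\
    exists2 n, (0 < n)%N & forall a, A a -> phi a = (psi a *+ n)%R.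
Proof.
move=> psiM.
pose Q := [pred q : T | `[< exists2 k, K k & cl k = q >]].
have /choice[s sP] q : exists k, q \in Q -> K k /\ cl k = q.
  have [[k Kk clk]|nQ] := pselect (exists2 k, K k & cl k = q).
    by exists k => _; split.
  by exists 1; rewrite inE => /nQ.
have clQ k : K k -> cl k \in Q by move=> Kk; rewrite inE; exists k.
have sK q : q \in Q -> K (s q) by move=> /sP[].
have sclK k : K k -> A (k / s (cl k)).
  by move=> Kk; apply/clP; rewrite ?(sP _ (clQ _ Kk)).2 //; apply/sK/clQ.
have KM := subgroupM Ksub; have KV := subgroupV Ksub.
pose act k q := cl (k * s q).
have actQ k q : K k -> q \in Q -> act k q \in Q.
  by move=> Kk Qq; apply/clQ/KM/sK.
have clA a k : A a -> K k -> cl (a * k) = cl k.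
  by move=> Aa Kk; apply/clP; rewrite ?mulgK //; apply: KM => //; apply: AK.
have actM k l q : K k -> K l -> q \in Q -> act (k * l) q = act k (act l q).
  move=> Kk Kl Qq; rewrite /act -mulgA; set t := s (cl _).
  have Kt : K t by apply/sK/clQ/KM/sK.
  have Alt : A (l * s q / t) by apply/sclK/KM/sK.
  rewrite -[l * s q](mulgVK t) mulgA -(Acent Alt Kk) -mulgA.
  by apply: clA => //; apply: KM.
have act1 q : q \in Q -> act 1 q = q by move=> /sP[_ clq]; rewrite /act mul1g.
pose zeta k q := k * s q / s (act k q).
have zetaA k q : K k -> q \in Q -> A (zeta k q).
  by move=> Kk Qq; apply/sclK/KM/sK.
have zetaM k l q : K k -> K l -> q \in Q ->
    zeta (k * l) q = zeta k (act l q) * zeta l q.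
  move=> Kk Kl Qq.
  rewrite (Acent (zetaA _ _ Kk (actQ _ _ Kl Qq)) (AK (zetaA _ _ Kl Qq))).
  rewrite {1}/zeta actM // [zeta k _]/zeta !mulgA (Acent (zetaA _ _ Kl Qq) Kk).
  by rewrite /zeta !mulgA mulgVK.
exists (fun k => \sum_(q in Q) psi (zeta k q))%R; split=> [k l Kk Kl|].
  rewrite (eq_bigr (fun q => psi (zeta k (act l q)) + psi (zeta l q)))%R; last first.
    move=> q Qq; rewrite zetaM //; apply: psiM; first exact/zetaA/actQ.
    exact: zetaA.
  rewrite big_split /=; congr (_ + _)%R.
  symmetry; rewrite (reindex_onto (act l) (act l^-1)) /=; last first.
    by move=> q Qq; rewrite -actM ?mulgV ?act1 //; apply: KV.
  apply: eq_bigl => q; apply/andP/idP => [[Qlq /eqP <-]|Qq].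
    by apply: actQ => //; apply: KV.
  split; first exact: actQ.
  by rewrite -actM ?mulVg ?act1 //; apply: KV.
exists #|Q|.
  by apply/card_gt0P; exists (cl 1); apply/clQ/(subgroup1 Ksub).
move=> a Aa; rewrite -sumr_const; apply: eq_bigr => q Qq; congr psi.
by have [Kq clq] := sP _ Qq; rewrite /zeta /act clA // clq mulgK.
Qed.
End Transfer.

(** * Groups generated by a finite conjugation-closed set *)

Lemma pigeonhole_nat (T : finType) (f : nat -> T) :
  exists i j, (i < j)%N /\ f j = f i.
Proof.
have [inj|] := boolP (injectiveb (fun i : 'I_#|T|.+1 => f i)).
  by have := leq_card _ (injectiveP _ inj); rewrite card_ord ltnn.
move=> /injectivePn[i [j ij e]].
case: (ltngtP i j) => [lt|lt|/val_inj eq]; last by rewrite eq eqxx in ij.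
  by exists i, j.
by exists j, i.
Qed.

(** The group K generated by a finite set s that is closed under conjugation
    by its own elements: a finitely generated group with finite conjugacy
    classes. *)
Section ConjugationClosed.
Local Open Scope group_scope.
Variables (G : groupType) (s : seq G).
Hypotheses (s_uniq : uniq s)
  (s_conj : forall x y, x \in s -> y \in s -> x ^ y \in s).

Let K := subgroup_generated [set` s].
Let Ksub : subgroup K := subgroup_generated_subgroup [set` s].

Let sK x : x \in s -> K x.
Proof. by move=> xs; apply: sub_subgroup_generated. Qed.

(** Conjugation by an element of s maps the finite set s into itself
    injectively, hence onto, so that inverses stabilize s as well. *)
Lemma conj_generated k x : K k -> (x ^ k \in s) = (x \in s).
Proof.
suff: K `<=` [set k | forall x, (x ^ k \in s) = (x \in s)] by move=> /[apply].
apply: subgroup_generated_min => [|y /= ys {}x].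
  apply: subgroupP => [{}x|k' l kP lP {}x]; first by rewrite conjg1.
  by rewrite conjgM -[LHS]lP conjgKV kP.
apply/idP/idP => [xys|xs]; last exact: s_conj.
have conj_sub : {subset [seq z ^ y | z <- s] <= s}.
  by move=> _ /mapP[z zs ->]; apply: s_conj.
have conj_uniq : uniq [seq z ^ y | z <- s].
  by rewrite map_inj_uniq //; apply: conjg_inj.
have [_ eq_s] := uniq_min_size conj_uniq conj_sub (eq_leq (esym (size_map _ _))).
by move: xys; rewrite -eq_s => /mapP[z zs /conjg_inj->].
Qed.

Let Z : set G := [set a | K a /\ forall k, K k -> commute a k].

Let Zsub : subgroup Z.
Proof.
apply: subgroupP => [|a b [Ka ca] [Kb cb]].
  by split=> [|k _]; [exact: subgroup1|exact/commute_sym/commute1].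
split=> [|k Kk]; first by apply: (subgroupM Ksub) => //; exact: (subgroupV Ksub).
apply: commute_sym; apply: commuteM; first exact/commute_sym/ca.
exact/commuteV/commute_sym/cb.
Qed.

Let center_generators a : K a -> (forall x, x \in s -> x ^ a = x) -> Z a.
Proof.
move=> Ka afix; split=> // k.
suff: K `<=` [set k | commute a k] by move=> /[apply].
apply: subgroup_generated_min => [|x /= /afix xa]; last by rewrite /commute [RHS]conjgC xa.
apply: subgroupP => [|x y xa ya]; first exact: commute1.
by apply: commuteM => //; apply: commuteV.
Qed.

(** The action of k on s, recorded as a function between finite types.  The
    extra value of the codomain is what [index] returns outside s. *)
Let cl (k : G) : {ffun 'I_(size s) -> 'I_(size s).+1} :=
  [ffun i : 'I_(size s) => inord (index (nth 1 s i ^ k) s)].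

Let clE k l : K k -> K l ->
  cl k = cl l <-> (forall x, x \in s -> x ^ k = x ^ l).
Proof.
move=> Kk Kl; split=> [/ffunP cle x xs|e]; last first.
  by apply/ffunP => i; rewrite !ffunE e ?mem_nth.
have := cle (Ordinal (etrans (index_mem x s) xs)); rewrite !ffunE /= nth_index //.
move=> /(congr1 val); rewrite /= !inordK ?ltnS ?index_size // => e.
by rewrite -[LHS](nth_index 1 (s := s)) ?conj_generated // e nth_index ?conj_generated.
Qed.

Let clP k l : K k -> K l -> cl k = cl l <-> Z (k / l).
Proof.
move=> Kk Kl; rewrite clE //; split=> [e|[_ Zkl] x xs].
  apply: center_generators => [|x xs].
    by apply: (subgroupM Ksub) => //; apply: (subgroupV Ksub).
  by rewrite conjgM e // conjgK.
rewrite -{1}(mulgVK l k) conjgM; congr (_ ^ l).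
apply: (mulgI (k / l)); rewrite -conjgC; symmetry; apply: Zkl; exact: sK.
Qed.

Let central_power x : K x -> exists2 n, (0 < n)%N & Z (x ^+ n).
Proof.
move=> Kx; have KX n : K (x ^+ n) := subgroupX Ksub n Kx.
have [j [i [ltij e]]] := pigeonhole_nat (fun i => cl (x ^+ i)).
exists (i - j)%N; first by rewrite subn_gt0.
rewrite (expgnFr x (ltnW ltij)).
by have [+ _] := clP (KX i) (KX j); apply.
Qed.

(** If x had infinite order, so would its power z = x ^+ N in the centre.  The
    transfer of a morphism sending z to 1 would then be nonzero at z, hence at
    x. *)
Lemma torsion_of_no_degree x : x \in s ->
    (forall phi : G -> rat,
       (forall k l, K k -> K l -> phi (k * l) = (phi k + phi l)%R) -> phi x = 0%R) ->
  exists2 n, (0 < n)%N & x ^+ n = 1.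
Proof.
move=> xs no_degree; apply: contrapT => xfree.
have [N N0 ZxN] := central_power (sK xs).
have [//|n n0 en|psi [psiM psi1]] := @abelian_subgroup_degree _ _ Zsub _ (x ^+ N) ZxN.
- by move=> a b [_ ca] [Kb _]; apply: ca.
- by apply: xfree; exists (N * n)%N; rewrite ?muln_gt0 ?N0 // expgnA.
have [//|a k [_ ca] /ca//|phi [phiM [m m0 phiE]]] :=
  @transfer _ K Z _ cl Ksub _ _ clP psi psiM.
  by move=> a [].
have phi1 : phi 1 = 0%R.
  have K1 := subgroup1 Ksub.
  by have := phiM _ _ K1 K1; rewrite mulg1 -{1}[phi 1]addr0 => /addrI.
have phiX n : phi (x ^+ n) = (phi x *+ n)%R.
  elim: n => [//|n IHn]; rewrite expgS phiM ?IHn ?mulrS //; first exact: sK.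
  exact: (subgroupX Ksub n (sK xs)).
have := phiE _ ZxN; rewrite psi1 phiX (no_degree phi phiM) mul0rn => /esym/eqP.
by rewrite pnatr_eq0; case: m m0 {phiE}.
Qed.

(** Moving an occurrence of x to the front of a product conjugates by x the
    letters that it jumps over.  These stay in s, and the remaining
    occurrences of x are unchanged, so this can be repeated N times. *)
Lemma word_shorten N w x : x \in s -> {subset w <= s} -> (N <= count_mem x w)%N ->
  exists v, [/\ {subset v <= s}, size v = (size w - N)%N &
    \prod_(y <- w) y = x ^+ N * \prod_(y <- v) y].
Proof.
move=> xs; elim: N w => [|N IHN] w ws cw.
  by exists w; split=> //; rewrite ?subn0 // mul1g.
have /path.splitPr ew : x \in w by rewrite -has_pred1 has_count; apply: leq_ltn_trans cw.
case: ew ws cw => w1 w2 ws cw.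
have w1s y : y \in w1 -> y \in s by move=> yw; apply: ws; rewrite mem_cat yw.
have w2s y : y \in w2 -> y \in s.
  by move=> yw; apply: ws; rewrite mem_cat inE yw !orbT.
pose w' := [seq y ^ x | y <- w1] ++ w2.
have [y yw||v [vs sv ev]] := IHN w'.
- move: yw; rewrite mem_cat => /orP[/mapP[z zw ->]|/w2s//].
  by apply: s_conj => //; apply: w1s.
- move: cw; rewrite !count_cat /= eqxx count_map addnCA add1n ltnS => cw.
  rewrite (eq_count (a2 := pred1 x)) // => y /=.
  by apply/eqP/eqP => [e|->]; [apply: (can_inj (conjgK x)); rewrite e|]; rewrite /conjg mulKg.
exists v; split=> //.
  by rewrite sv !size_cat /= size_map addnS subSS.
have moveL : \prod_(y <- w1) y * x = x * \prod_(y <- [seq y ^ x | y <- w1]) y.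
  by rewrite big_map -conjg_prod conjgC.
by rewrite expgS -mulgA -ev big_cat big_cons /= mulgA moveL -mulgA -big_cat.
Qed.

(** Dietzmann's lemma.  If N is a common exponent of the elements of s, a word
    of more than N * size s letters contains some letter N times, and
    [word_shorten] deletes these N letters.  Hence every element of K is a
    product of at most N * size s elements of s. *)
Lemma finite_generated_torsion :
  (forall x, x \in s -> exists2 n, (0 < n)%N & x ^+ n = 1) -> finite_set K.
Proof.
move=> tors.
have [N N0 NP] : exists2 N, (0 < N)%N & forall x, x \in s -> x ^+ N = 1.
  elim: s tors => [|x t IHt] tors; first by exists 1%N.
  have [n n0 xn] := tors x (mem_head _ _).
  have [|N N0 NP] := IHt; first by move=> y yt; apply: tors; rewrite inE yt orbT.
  exists (n * N)%N; rewrite ?muln_gt0 ?n0 // => y; rewrite inE => /orP[/eqP->|/NP yN].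
    by rewrite expgnA xn expg1n.
  by rewrite mulnC expgnA yN expg1n.
pose L := (size s * N)%N.
pose word := [set \prod_(y <- w) y | w in [set w : seq G | {subset w <= s}]].
have wordM x y : word x -> word y -> word (x * y).
  move=> [w ws <-] [v vs <-]; exists (w ++ v); last by rewrite big_cat.
  by move=> z; rewrite mem_cat => /orP[/ws|/vs].
have wordV x : word x -> word x^-1.
  move=> [w ws <-]; elim: w ws => [|y w IHw] ws.
    by rewrite big_nil invg1; exists [::]; rewrite ?big_nil.
  have ys : y \in s by apply: ws; rewrite mem_head.
  rewrite big_cons invgM; apply: wordM.
    by apply: IHw => z zw; apply: ws; rewrite inE zw orbT.
  exists (nseq N.-1 y); first by move=> z /nseqP[->].
  rewrite big_nseq iter_mulg_1; apply: (mulgI y).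
  by rewrite -expgS prednK // NP // mulgV.
have Kword : K `<=` word.
  apply: subgroup_generated_min => [|x /= xs]; last first.
    by exists [:: x]; rewrite ?big_seq1 // => y; rewrite inE => /eqP->.
  apply: subgroupP => [|x y wx wy]; first by exists [::]; rewrite ?big_nil.
  exact/wordM/wordV.
have short x : word x -> exists2 w, {subset w <= s} & (size w <= L)%N /\ \prod_(y <- w) y = x.
  case=> w + <-; elim: {w}(size w) {-2}w (leqnn (size w)) => [|n IHn] w.
    by rewrite leqn0 size_eq0 => /eqP-> ws; exists [::].
  move=> wn ws; case: (leqP (size w) L) => [|Lw]; first by exists w.
  have [y ys cy] : exists2 y, y \in s & (N <= count_mem y w)%N.
    apply/hasP; rewrite -[has _ _]negbK -all_predC; apply/negP => /allP few.
    move: Lw; rewrite ltnNge => /negP; apply.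
    have -> : size w = (\sum_(y <- s) count_mem y w)%N.
      under eq_bigr => y _ do rewrite -sum1_count big_mkcond.
      rewrite exchange_big /= -sum1_size; apply: eq_big_seq => z /ws zs.
      rewrite -big_mkcond sum1_count (eq_count (a2 := pred1 z)) => [|y].
        by rewrite count_uniq_mem // zs.
      by rewrite /= eq_sym.
    have -> : L = (\sum_(y <- s) N)%N.
      by rewrite big_const_seq count_predT iter_addn_0 mulnC.
    rewrite !big_seq; apply: leq_sum => y /few.
    by rewrite /= -ltnNge => /ltnW.
  have [v [vs sv ->]] := word_shorten ys ws cy.
  rewrite NP // mul1g; apply: IHn => //.
  by rewrite sv leq_subLR (leq_trans wn) // -add1n leq_add2r.
have : finite_set [set \prod_(i <- t) nth 1 s i | t in [set: L.-tuple 'I_(size s).+1]].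
  exact/finite_image/finite_finset.
apply: sub_finite_set => x /Kword/short[w ws [wL <-]].
(* Short words are padded with the index size s, which [nth] sends to 1. *)
pose t : seq 'I_(size s).+1 :=
  [seq inord (index y s) | y <- w] ++ nseq (L - size w) ord_max.
have t_size : size t == L.
  by rewrite size_cat size_map size_nseq subnKC.
exists (Tuple t_size) => //=.
rewrite big_cat /= [X in _ * X]big1_seq ?mulg1; last first.
  by move=> i /andP[_ /nseqP[-> _]]; rewrite nth_default.
rewrite big_map; apply: eq_big_seq => y yw.
by rewrite inordK ?ltnS ?index_size // nth_index // ws.
Qed.

End ConjugationClosed.

(** * Rings without unit *)

Section RngTheory.
Variable R : rngType.
Implicit Types x y z : R.

Lemma rng_mul0 x : (0%R * x)%g = 0 :> R.
Proof. by apply: (addrI (0 * x)%g); rewrite -rng_mulDl !addr0. Qed.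

Lemma rng_mulr0 x : (x * 0%R)%g = 0 :> R.
Proof. by apply: (addrI (x * 0%R)%g); rewrite -rng_mulDr !addr0. Qed.

Lemma rng_suml I (r : seq I) (P : pred I) (F : I -> R) y :
  ((\sum_(i <- r | P i) F i)%R * y)%g = \sum_(i <- r | P i) (F i * y)%g.
Proof.
exact: (big_morph (fun x => (x * y)%g) (fun a b => rng_mulDl a b y) (rng_mul0 y)).
Qed.

Lemma rng_sumr I (r : seq I) (P : pred I) (F : I -> R) x :
  (x * (\sum_(i <- r | P i) F i)%R)%g = \sum_(i <- r | P i) (x * F i)%g.
Proof. exact: (big_morph (fun y => (x * y)%g) (rng_mulDr x) (rng_mulr0 x)). Qed.

Lemma rng_mulnl x n y : ((x *+ n)%R * y)%g = (x * y)%g *+ n.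
Proof.
by elim: n => [|n IHn]; rewrite ?rng_mul0 // !mulrS rng_mulDl IHn.
Qed.

Lemma rng_mulnr x y n : (x * (y *+ n)%R)%g = (x * y)%g *+ n.
Proof.
by elim: n => [|n IHn]; rewrite ?rng_mulr0 // !mulrS rng_mulDr IHn.
Qed.

Lemma rng_mulNl x y : ((- x)%R * y)%g = - (x * y)%g.
Proof. by apply/eqP; rewrite -addr_eq0 -rng_mulDl addNr rng_mul0. Qed.

Lemma rng_mulNr x y : (x * (- y)%R)%g = - (x * y)%g.
Proof. by apply/eqP; rewrite -addr_eq0 -rng_mulDr addNr rng_mulr0. Qed.
End RngTheory.

Lemma additive_subgroupP (R : rngType) (A : set R) : additive_subgroup A <->
  A 0 /\ forall x y, A x -> A y -> A (x - y).
Proof.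
split=> [[A0 AB]|[A0 AB]]; rewrite ?inE in A0 *.
  by split=> // x y /mem_set xA /mem_set yA; apply/set_mem/AB.
by split=> [|x y]; rewrite !inE //; apply: AB.
Qed.

(** * Components in a graded ring *)

Section GradedRing.
Variables (G : groupType) (R : rngType) (R_ : G -> set R).
Hypothesis R_graded : graded R_.

Let comp := component R_.

Let hom_add g : additive_subgroup (R_ g).
Proof. by case: R_graded. Qed.

Lemma hom0 g : R_ g 0.
Proof. by have /additive_subgroupP[] := hom_add g. Qed.

Lemma homB g x y : R_ g x -> R_ g y -> R_ g (x - y).
Proof. by have /additive_subgroupP[_] := hom_add g; apply. Qed.

Lemma homN g x : R_ g x -> R_ g (- x).
Proof. by move=> xR; rewrite -sub0r; apply: homB => //; apply: hom0. Qed.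

Lemma homD g x y : R_ g x -> R_ g y -> R_ g (x + y).
Proof. by move=> xR yR; rewrite -(opprK y); apply/homB/homN. Qed.

Lemma homMn g x n : R_ g x -> R_ g (x *+ n).
Proof.
move=> xR; elim: n => [|n IHn]; first exact: hom0.
by rewrite mulrS; apply: homD.
Qed.

Lemma homM g h x y : R_ g x -> R_ h y -> R_ (g * h)%g (x * y)%g.
Proof.
move=> xR yR; case: R_graded => _ _; apply.
by exists 1%N, (fun=> x), (fun=> y); split=> //; rewrite big_ord1.
Qed.

Lemma fsum_seq (c : G -> R) (s : seq G) : uniq s ->
  (forall g, c g <> 0 -> g \in s) ->
  \sum_(g \in [set: G]) c g = \sum_(g <- s) c g.
Proof.
move=> s_uniq cs; rewrite [RHS]fsbig_seq //; symmetry; apply: fsbig_widen => // g [_].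
rewrite /= => gs; apply: contrapT => cg; apply: gs; exact: cs.
Qed.

Lemma decomposition_component r : decomposition R_ r (comp r).
Proof. by case: R_graded => _ /(_ r)[c [cP _]] _; apply: xgetPex; exists c. Qed.

Lemma component_hom r g : R_ g (comp r g).
Proof. by have [] := decomposition_component r. Qed.

(** The form in which the uniqueness of decompositions is used: with a sum over
    an explicit finite sequence that may be larger than the support. *)
Lemma component_uniq r c (s : seq G) : uniq s -> (forall g, c g <> 0 -> g \in s) ->
  (forall g, R_ g (c g)) -> r = \sum_(g <- s) c g -> comp r = c.
Proof.
move=> s_uniq cs cR er; case: R_graded => _ /(_ r)[d [_ d_uniq]] _.
rewrite -[RHS]d_uniq; first exact/esym/d_uniq/decomposition_component.
split=> //; last by rewrite (fsum_seq s_uniq).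
by apply: (sub_finite_set _ (finite_seq s)) => g /cs.
Qed.

Lemma Supp_seq r : exists s : seq G, uniq s /\ Supp R_ r = [set` s].
Proof.
have [/finite_seqP[s es] _ _] := decomposition_component r.
exists (undup s); split; first exact: undup_uniq.
by rewrite /Supp es; apply/seteqP; split=> g; rewrite /= mem_undup.
Qed.

Lemma component_sum r (s : seq G) : uniq s -> Supp R_ r `<=` [set` s] ->
  r = \sum_(g <- s) comp r g.
Proof.
move=> s_uniq rs; have [_ _ {1}->] := decomposition_component r.
by apply: fsum_seq => // g /rs.
Qed.

Lemma component_id g r : R_ g r -> comp r = fun h => if h == g then r else 0.
Proof.
move=> rR; apply: (@component_uniq _ _ [:: g]) => //.
- by move=> h; rewrite inE; case: eqP.
- by move=> h; case: eqP => [->|_] //; apply: hom0.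
- by rewrite big_seq1 eqxx.
Qed.

Lemma componentD r t g : comp (r + t) g = comp r g + comp t g.
Proof.
have [s [_ es]] := Supp_seq r; have [u [_ eu]] := Supp_seq t.
have v_uniq := undup_uniq (s ++ u).
have sv : Supp R_ r `<=` [set` undup (s ++ u)].
  by rewrite es => h /= hs; rewrite mem_undup mem_cat hs.
have uv : Supp R_ t `<=` [set` undup (s ++ u)].
  by rewrite eu => h /= hs; rewrite mem_undup mem_cat hs orbT.
rewrite (component_uniq (c := fun g => comp r g + comp t g) v_uniq) //.
- move=> h; apply: contra_notP => hv.
  have -> : comp r h = 0 by apply: contrapT => /(sv h)/hv.
  have -> : comp t h = 0 by apply: contrapT => /(uv h)/hv.
  exact: addr0.
- by move=> h; apply: homD; apply: component_hom.
- by rewrite big_split /= -!component_sum.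
Qed.

Lemma component_mulr f h x g : R_ h x -> comp (f * x)%g (g * h)%g = (comp f g * x)%g.
Proof.
move=> xR; have [s [s_uniq es]] := Supp_seq f.
rewrite (@component_uniq _ (fun k => comp f (k * h^-1) * x)%g
  [seq (k * h)%g | k <- s]) ?mulgK //.
- by rewrite map_inj_uniq //; apply: mulIg.
- move=> k; apply: contra_notP => ks.
  have -> : comp f (k / h)%g = 0; last exact: rng_mul0.
  apply: contrapT => kf; apply: ks; rewrite -(mulgVK h k); apply: map_f.
  by have : Supp R_ f (k / h)%g by []; rewrite es.
- move=> k; rewrite -{1}(mulgVK h k); apply: homM => //; exact: component_hom.
- rewrite {1}(component_sum s_uniq (r := f)) ?es // rng_suml big_map.
  by apply: eq_bigr => k _; rewrite mulgK.
Qed.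

Lemma component_mull f h x g : R_ h x -> comp (x * f)%g (h * g)%g = (x * comp f g)%g.
Proof.
move=> xR; have [s [s_uniq es]] := Supp_seq f.
rewrite (@component_uniq _ (fun k => x * comp f (h^-1 * k))%g
  [seq (h * k)%g | k <- s]) ?mulKg //.
- by rewrite map_inj_uniq //; apply: mulgI.
- move=> k; apply: contra_notP => ks.
  have -> : comp f (h^-1 * k)%g = 0; last exact: rng_mulr0.
  apply: contrapT => kf; apply: ks; rewrite -(mulVKg h k); apply: map_f.
  by have : Supp R_ f (h^-1 * k)%g by []; rewrite es.
- move=> k; rewrite -{1}(mulVKg h k); apply: homM => //; exact: component_hom.
- rewrite {1}(component_sum s_uniq (r := f)) ?es // rng_sumr big_map.
  by apply: eq_bigr => k _; rewrite mulKg.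
Qed.

(** Both sides are the component of f x = x f at g * h = h * (g ^ h). *)
Lemma central_component f g h x : central_elt f -> R_ h x ->
  (comp f g * x = x * comp f (g ^ h))%g.
Proof.
move=> fC xR; rewrite -(component_mulr f g xR) -(component_mull f (g ^ h)%g xR) fC.
by rewrite -conjgC.
Qed.

(** * Derivatives of a central idempotent *)

Section Rescaling.

(** The additive map that multiplies the component at g by nu g.  For
    nu g = 'C(w g, k) it is the k-th Hasse derivative at 1 for the degree w. *)
Definition rescale (nu : G -> nat) (r : R) : R :=
  \sum_(g \in [set: G]) (comp r g *+ nu g).

Lemma rescale_seq nu r (s : seq G) : uniq s -> Supp R_ r `<=` [set` s] ->
  rescale nu r = \sum_(g <- s) comp r g *+ nu g.
Proof.
move=> s_uniq rs; apply: fsum_seq => // g gr; apply: rs => e; apply: gr.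
by rewrite [comp r g]e mul0rn.
Qed.

Lemma component_rescale nu r g : comp (rescale nu r) g = comp r g *+ nu g.
Proof.
have [s [s_uniq es]] := Supp_seq r.
rewrite (component_uniq (c := fun g => comp r g *+ nu g) s_uniq) //.
- move=> h ch; have : Supp R_ r h; last by rewrite es.
  by move=> e; apply: ch; rewrite [comp r h]e mul0rn.
- by move=> h; apply/homMn/component_hom.
- by apply: rescale_seq; rewrite ?es.
Qed.

Lemma rescale_id nu g r : R_ g r -> rescale nu r = r *+ nu g.
Proof.
move=> rR; rewrite (@rescale_seq _ _ [:: g]) ?big_seq1 ?(component_id rR) ?eqxx //.
move=> h; rewrite /Supp /= -/comp (component_id rR) inE.
by case: eqP.
Qed.

Lemma rescaleD nu : {morph rescale nu : r t / r + t}.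
Proof.
move=> r t.
have [s [_ es]] := Supp_seq r; have [u [_ eu]] := Supp_seq t.
have [v [_ ev]] := Supp_seq (r + t).
have w_uniq := undup_uniq (s ++ u ++ v).
rewrite !(rescale_seq nu w_uniq); first 1 last.
- by rewrite eu => g /= gu; rewrite mem_undup !mem_cat gu orbT.
- by rewrite es => g /= gu; rewrite mem_undup !mem_cat gu.
- by rewrite ev => g /= gu; rewrite mem_undup !mem_cat gu !orbT.
by rewrite -big_split; apply: eq_bigr => g _; rewrite componentD mulrnDl.
Qed.

Lemma rescale0 nu : rescale nu 0 = 0.
Proof. by rewrite (rescale_id nu (hom0 1%g)) mul0rn. Qed.

End Rescaling.

(** In the application w is a degree shifted by m to make it nonnegative, so
    that w2, the weight of products of two components, is shifted by 2 m. *)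
Section Idempotent.
Variable f : R.
Hypotheses (fC : central_elt f) (fI : idempotent_elt f).
Variables (w w2 : G -> nat) (m : nat).
Hypotheses (w2_mul : forall g h, Supp R_ f g -> Supp R_ f h ->
                       w2 (g * h)%g = (w g + w h)%N)
           (w2_shift : forall g, Supp R_ f g -> w2 g = (w g + m)%N).

Let E k := rescale (fun g => 'C(w g, k)) f.

(** Both sides are the k-th derivative of f = f f for the weight w2: on the
    left by the Leibniz rule, that is Vandermonde's identity for
    w g + w h, on the right by the same identity for w g + m. *)
Let E_conv k : \sum_(i < k.+1) (E i * E (k - i)%N)%g
             = \sum_(i < k.+1) E i *+ 'C(m, k - i).
Proof.
have [s [s_uniq es]] := Supp_seq f.
have sf g : g \in s -> Supp R_ f g by rewrite es.
have Es nu : rescale nu f = \sum_(g <- s) comp f g *+ nu g.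
  by apply: rescale_seq; rewrite ?es.
have fs : f = \sum_(g <- s) comp f g by apply: component_sum; rewrite ?es.
transitivity (rescale (fun g => 'C(w2 g, k)) f); last first.
  rewrite Es; under [RHS]eq_bigr => i _ do rewrite /E Es -sumrMnl.
  rewrite exchange_big /=; apply: eq_big_seq => g /sf gf.
  rewrite w2_shift // -binomial.Vandermonde -sumrMnr.
  by apply: eq_bigr => i _; rewrite mulrnA.
rewrite -[in RHS]fI [in RHS]fs rng_suml.
rewrite (big_morph _ (rescaleD _) (rescale0 _)).
under [LHS]eq_bigr => i _ do rewrite /E Es rng_suml.
rewrite exchange_big /=; apply: eq_big_seq => g /sf gf.
rewrite rng_sumr (big_morph _ (rescaleD _) (rescale0 _)).
under [LHS]eq_bigr => i _ do rewrite Es rng_sumr.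
rewrite exchange_big /=; apply: eq_big_seq => h /sf hf.
rewrite (rescale_id _ (homM (component_hom f g) (component_hom f h))) w2_mul //.
rewrite -binomial.Vandermonde -sumrMnr; apply: eq_bigr => i _.
by rewrite rng_mulnl rng_mulnr mulrnA mulrnAC.
Qed.

(** By induction the middle terms of [E_conv] agree, and the two outer ones
    leave 2 f E_k = 'C(m, k) f + E_k.  Multiplying by f gives
    f E_k = 'C(m, k) f, and hence E_k = 'C(m, k) f. *)
Let E_binomial k : E k = f *+ 'C(m, k).
Proof.
elim/ltn_ind: k => k IHk; have := E_conv k.
have E0 : E 0%N = f.
  have [s [s_uniq es]] := Supp_seq f.
  rewrite /E (rescale_seq _ s_uniq) ?es // [RHS](component_sum s_uniq) ?es //.
  by apply: eq_bigr => g _; rewrite bin0.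
case: k IHk => [|k] IHk; first by rewrite E0 bin0.
rewrite big_ord_recl big_ord_recr [RHS]big_ord_recl [in RHS]big_ord_recr /=.
rewrite !subn0 /bump /= !add1n subnn E0 bin0 mulr1n !addrA.
rewrite (eq_bigr (fun i : 'I_k => E i.+1 *+ 'C(m, k.+1 - i.+1))); last first.
  move=> i _; rewrite /bump /= add1n IHk ?ltnS ?ltn_ord //.
  rewrite IHk ?subSS ?(leq_ltn_trans (leq_subr _ _)) //.
  by rewrite rng_mulnl rng_mulnr fI mulrnAC.
rewrite addrAC [X in _ = X]addrAC => /addIr e.
have fE : (f * E k.+1 = E k.+1 * f)%g by rewrite fC.
rewrite -fE in e.
have e2 := congr1 (fun x => (f * x)%g) e.
rewrite /= !rng_mulDr !mulgA fI rng_mulnr fI in e2.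
by move/addIr: e2 => e2; move: e; rewrite e2 => /addrI.
Qed.

(** By [E_binomial] the coefficients 'C(w g, k) and 'C(m, k) act alike on the
    component at g for all k.  If w g and m differ, taking for k the larger one
    makes one coefficient 0 and the other 1. *)
Lemma idempotent_weight_const g : Supp R_ f g -> w g = m.
Proof.
move=> gf; have eC k : comp f g *+ 'C(w g, k) = comp f g *+ 'C(m, k).
  rewrite -(component_rescale (fun g => 'C(w g, k))).
  rewrite -(component_rescale (fun=> 'C(m, k))); congr (component R_ _ g).
  rewrite [LHS]E_binomial; have [s [s_uniq es]] := Supp_seq f.
  by rewrite (rescale_seq _ s_uniq) ?es // sumrMnl -component_sum ?es.
case: (ltngtP (w g) m) => // lt; exfalso; apply: gf.
  by have := eC m; rewrite bin_small // binn.
by have := eC (w g); rewrite (bin_small lt) binn.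
Qed.

End Idempotent.

(** With D a common denominator of phi on the support, the weight is D phi,
    shifted by a bound m of its absolute value on the support. *)
Lemma idempotent_degree f (phi : G -> rat) : central_elt f -> idempotent_elt f ->
  (forall g h, Supp R_ f g -> Supp R_ f h -> phi (g * h)%g = phi g + phi h) ->
  forall g, Supp R_ f g -> phi g = 0.
Proof.
move=> fC fI phiM; have [s [s_uniq es]] := Supp_seq f.
have [D D0 DP] : exists2 D : int, D != 0 &
    forall g, g \in s -> phi g * D%:~R \is a Num.int.
  elim: s {s_uniq es} => [|g s [D D0 DP]]; first by exists 1.
  exists (denq (phi g) * D); first by rewrite mulf_neq0 ?denq_eq0.
  move=> h; rewrite inE rmorphM /= => /orP[/eqP->|/DP hD].
    by rewrite mulrA -numqE rpredM ?intr_int.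
  by rewrite mulrCA rpredM ?intr_int.
pose d g := Num.floor (phi g * D%:~R).
have dE g : Supp R_ f g -> (d g)%:~R = phi g * D%:~R.
  by rewrite es => /DP /floorK.
pose m := (\sum_(g <- s) `|d g|)%N.
have dm g : Supp R_ f g -> (`|d g| <= m)%N.
  by rewrite es /= => gs; rewrite /m (big_rem g) //= leq_addr.
have dM g h : Supp R_ f g -> Supp R_ f h -> d (g * h)%g = d g + d h.
  by move=> gf hf; rewrite {1}/d phiM // mulrDl -!dE // -rmorphD intrKfloor.
move=> g gf; have /= := @idempotent_weight_const f fC fI (fun g => absz (d g + m%:Z))
  (fun g => absz (d g + m%:Z + m%:Z)) m _ _ g gf.
move=> eg; have {eg} : absz (d g + m%:Z) = m.
  apply: eg => h => [k hf kf|hf].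
    by rewrite dM //; have := dm h hf; have := dm k kf; lia.
  by have := dm h hf; lia.
move=> e; have d0 : d g = 0 by have := dm g gf; lia.
by have /esym/eqP := dE g gf; rewrite d0 mulf_eq0 intr_eq0 (negPf D0) orbF => /eqP.
Qed.

(** * Homogeneous elements centralizing a prime R_e *)

Section Nondegenerate.
Hypotheses (Re_prime : prime_subring (R_ 1%g))
  (R_nondeg : right_nondegenerate R_ \/ left_nondegenerate R_).

Lemma setprod_sub (A B I : set R) : additive_subgroup I ->
  (forall a b, A a -> B b -> I (a * b)%g) -> setprod A B `<=` I.
Proof.
move=> /additive_subgroupP[I0 IB] AB _ [n [a [b [Aa Bb ->]]]].
apply: (big_ind I) => // [x y Ix Iy|i _]; last exact: AB.
by rewrite -(opprK y); apply: (IB) => //; rewrite -sub0r; apply: IB.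
Qed.

Lemma setprod_eq0 (A B : set R) :
  (forall a b, A a -> B b -> (a * b)%g = 0) -> setprod A B = [set 0].
Proof.
move=> AB; apply/seteqP; split=> [|_ ->].
  apply: setprod_sub => //; apply/additive_subgroupP; split=> // x y /= -> ->.
  by rewrite subr0.
by exists 0%N, (fun=> 0), (fun=> 0); split; [case|case|rewrite big_ord0].
Qed.

Section CentralizingHomogeneous.
Variables (g : G) (a : R).
Hypotheses (aR : R_ g a) (aC : forall x, R_ 1%g x -> (a * x = x * a)%g).

Definition right_span : set R := [set (a * b)%g | b in R_ g^-1%g].
Definition left_span : set R := [set (b * a)%g | b in R_ g^-1%g].

Lemma ideal_right_span : ideal_of (R_ 1%g) right_span.
Proof.
have addI : additive_subgroup right_span.
  apply/additive_subgroupP; split.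
    by exists 0; rewrite ?rng_mulr0 //; apply: hom0.
  move=> _ _ [b bR <-] [c cR <-]; exists (b - c); first exact: homB.
  by rewrite rng_mulDr rng_mulNr.
split=> //.
- by move=> _ [b bR <-]; rewrite -(mulgV g); apply: homM.
- apply: setprod_sub => // x _ xR [b bR <-].
  by exists (x * b)%g; [rewrite -[g^-1%g]mul1g; apply: homM|rewrite !mulgA aC].
- apply: setprod_sub => // _ x [b bR <-] xR.
  by exists (b * x)%g; [rewrite -[g^-1%g]mulg1; apply: homM|rewrite mulgA].
Qed.

Lemma ideal_left_span : ideal_of (R_ 1%g) left_span.
Proof.
have addI : additive_subgroup left_span.
  apply/additive_subgroupP; split.
    by exists 0; rewrite ?rng_mul0 //; apply: hom0.
  move=> _ _ [b bR <-] [c cR <-]; exists (b - c); first exact: homB.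
  by rewrite rng_mulDl rng_mulNl.
split=> //.
- by move=> _ [b bR <-]; rewrite -(mulVg g); apply: homM.
- apply: setprod_sub => // x _ xR [b bR <-].
  by exists (x * b)%g; [rewrite -[g^-1%g]mul1g; apply: homM|rewrite mulgA].
- apply: setprod_sub => // _ x [b bR <-] xR.
  by exists (b * x)%g; [rewrite -[g^-1%g]mulg1; apply: homM|rewrite -!mulgA aC].
Qed.

(** Non-degeneracy gives one of the two.  The square of a R_(g^-1) lies in
    a (R_(g^-1) a) R_(g^-1), and that of R_(g^-1) a in
    R_(g^-1) (a R_(g^-1)) a, so by primeness neither vanishes alone. *)
Lemma spans_neq0 : a <> 0 -> right_span <> [set 0] /\ left_span <> [set 0].
Proof.
move=> a0; have [_ prime] := Re_prime.
have right_left : right_span = [set 0] -> left_span = [set 0].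
  move=> I0; suff: setprod left_span left_span = [set 0].
    by move/prime => /(_ ideal_left_span ideal_left_span)[].
  apply: setprod_eq0 => _ _ [b bR <-] [c cR <-].
  have : right_span (a * c)%g by exists c.
  by rewrite I0 => /= ac; rewrite mulgA -(mulgA b) ac rng_mulr0 rng_mul0.
have left_right : left_span = [set 0] -> right_span = [set 0].
  move=> J0; suff: setprod right_span right_span = [set 0].
    by move/prime => /(_ ideal_right_span ideal_right_span)[].
  apply: setprod_eq0 => _ _ [b bR <-] [c cR <-].
  have : left_span (b * a)%g by exists b.
  by rewrite J0 => /= ba; rewrite mulgA -(mulgA a) ba rng_mulr0 rng_mul0.
case: R_nondeg => [/(_ _ _ aR a0)|/(_ _ _ aR a0)] nz.
  have I0 : right_span <> [set 0].
    move=> I0; apply: nz; apply: setprod_eq0 => _ b -> bR.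
    by have : right_span (a * b)%g by [exists b]; rewrite I0.
  by split=> // /left_right.
have J0 : left_span <> [set 0].
  move=> J0; apply: nz; apply: setprod_eq0 => b _ bR ->.
  by have : left_span (b * a)%g by [exists b]; rewrite J0.
by split=> // /right_left.
Qed.

End CentralizingHomogeneous.

(** If a b = 0, then the product of the nonzero ideals R_(g^-1) a and
    b R_(h^-1) of R_e vanishes. *)
Lemma centralizing_mul_neq0 g h a b : R_ g a -> R_ h b ->
  (forall x, R_ 1%g x -> (a * x = x * a)%g) ->
  (forall x, R_ 1%g x -> (b * x = x * b)%g) ->
  a <> 0 -> b <> 0 -> (a * b)%g <> 0.
Proof.
move=> aR bR aC bC a0 b0 ab0.
have [_ J0] := spans_neq0 aR aC a0; have [I0 _] := spans_neq0 bR bC b0.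
have [_ prime] := Re_prime.
have [|/J0|/I0] := prime _ _ (ideal_left_span aR aC) (ideal_right_span bR bC) => //.
apply: setprod_eq0 => _ _ [c cR <-] [d dR <-].
by rewrite mulgA -(mulgA c) ab0 rng_mulr0 rng_mul0.
Qed.

(** For x = f_h, [central_component] reads f_g f_h = f_h f_(g ^ h), where the
    left-hand side is nonzero. *)
Lemma Supp_conj f g h : central_elt f ->
  Supp R_ f g -> Supp R_ f h -> Supp R_ f (g ^ h)%g.
Proof.
move=> fC gf hf gh0.
have compC k x : R_ 1%g x -> (comp f k * x = x * comp f k)%g.
  by move=> xR; rewrite (central_component k fC xR) conjg1.
apply: (centralizing_mul_neq0 (component_hom f g) (component_hom f h)
  (compC g) (compC h) gf hf).
by rewrite (central_component g fC (component_hom f h)) [comp f (g ^ h)%g]gh0 rng_mulr0.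
Qed.

Lemma Supp_torsion f g : central_elt f -> idempotent_elt f -> Supp R_ f g ->
  exists2 n, (0 < n)%N & (g ^+ n = 1)%g.
Proof.
move=> fC fI; have [s [s_uniq es]] := Supp_seq f; rewrite es => gs.
apply: (torsion_of_no_degree s_uniq) => [x y xs ys||phi phiM] //.
  have := @Supp_conj f x y fC; rewrite es; exact.
apply: (idempotent_degree fC fI); last by rewrite es.
by move=> x y; rewrite es => xs ys; apply: phiM; apply: sub_subgroup_generated.
Qed.

End Nondegenerate.
End GradedRing.

(** * Central idempotents *)

Theorem corollary2p3 (G : groupType) (R : rngType) (R_ : G -> set R)
    (R_graded : graded R_)
    (Re_prime : prime_subring (R_ 1%g))
    (R_nondeg : right_nondegenerate R_ \/ left_nondegenerate R_) :
  (forall f : R, f <> 0 -> central_elt f -> idempotent_elt f ->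
     finite_set (support_group R_ f)) /\
  (torsion_free G ->
     forall f : R, central_elt f -> idempotent_elt f -> R_ 1%g f).
Proof.
split=> [f _ fC fI|tf f fC fI]; have [s [s_uniq es]] := Supp_seq R_graded f.
  rewrite /support_group es; apply: finite_generated_torsion => // [x y xs ys|x xs].
    have := Supp_conj R_graded Re_prime R_nondeg (g := x) (h := y) fC.
    by rewrite es; apply.
  by apply: (Supp_torsion R_graded Re_prime R_nondeg fC fI); rewrite es.
rewrite (component_sum R_graded s_uniq (r := f)) ?es // big_seq.
apply: (big_ind (R_ 1%g)) => [|x y|g gs]; first exact: hom0.
  exact: homD.
have gf : Supp R_ f g by rewrite es.
have [n n0 /(tf _ _ n0) <-] := Supp_torsion R_graded Re_prime R_nondeg fC fI gf.
exact: component_hom.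
Qed.
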